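(* Let $t_0<T$ be fixed, let $x_0\in\mathbb{R}^n$, let $E$ and $I$ be finite nonempty disjoint index sets, and let $\Phi^k$, $k\in E\cup I$, be continuously differentiable real-valued functions of $(x,t)\in\mathbb{R}^n\times\mathbb{R}$. Consider the optimal control problem described in the context with terminal constraints $\Phi^k(x(T),T)=0$ for $k\in E$ and $\Phi^j(x(T),T)\le0$ for $j\in I$. Let $(x^*,u^* )$ be an optimal pair with $\Phi^k(x^*(T),T)=0$ for all $k\in E\cup I$, and put $z^*=\dot x^*$. Suppose that at all points of a neighborhood of the admissible set the following hold: (1) the gradients $\nabla\Phi^k(x(T),T)$, $k\in E$, are linearly independent; (2) there exists $d\in\mathbb{R}^n$ such that $\langle\nabla\Phi^k(x(T),T),d\rangle=0$ for all $k\in E$ and $\langle\nabla\Phi^j(x(T),T),d\rangle<0$ for all $j\in I$. Then there exist a neighborhood $B$ of $(z^*,u^* )$ and a constant $a>0$ such that for all $(z,u)\in B$ with $\phi_{\mathrm{term}}(z)>0$, $$\operatorname{dist}\bigl(0,\partial\phi_{\mathrm{term}}(z)\bigr)\ge a .$$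
   Context: Setting: minimize $\Phi^0(x(T),T)$, with $\Phi^0$ continuously differentiable, over piecewise continuous controls $u$ with values in a compact set $V\subset\mathbb{R}^m$ and piecewise continuously differentiable states $x:[t_0,T]\to\mathbb{R}^n$ subject to $\dot x(t)=f(x(t),u(t),t)$, $x(t_0)=x_0$, and the terminal constraints. The map $f$ is differentiable in $x$, Lipschitz in $x$ uniformly in $(u,t)$, and $f$ and $\partial f/\partial x$ are continuous. The state is parametrized by its derivative $z=\dot x$ (piecewise continuous, $\mathbb{R}^n$-valued on $[t_0,T]$): $x(t)=x_0+\int_{t_0}^t z(\tau)\,d\tau$, $x_T=x(T)$. The admissible set is the set of pairs $(z,u)$ satisfying the dynamics, the control constraint and the terminal constraints; neighborhoods of it and of $(z^*,u^* )$ are in the $L_2\times L_2$ topology. The terminal penalty is $$\phi_{\mathrm{term}}(z)=\max_{k\in E,\ j\in I}\{|\Phi^k(x_T,T)|,\ \Phi^j(x_T,T)\}.$$ For $\phi_{\mathrm{term}}(z)>0$ put $E_{\mathrm{act}}(z)=\{k\in E:|\Phi^k(x_T,T)|=\phi_{\mathrm{term}}(z)\}$, $I_{\mathrm{act}}(z)=\{j\in I:\Phi^j(x_T,T)=\phi_{\mathrm{term}}(z)\}$; then $$\partial\phi_{\mathrm{term}}(z)=\operatorname{co}\bigl(\{\operatorname{sign}(\Phi^k(x_T,T))\nabla\Phi^k(x_T,T):k\in E_{\mathrm{act}}(z)\}\cup\{\nabla\Phi^j(x_T,T):j\in I_{\mathrm{act}}(z)\}\bigr)\subset\mathbb{R}^n,$$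 with gradients in the spatial variable $x$ and $\operatorname{co}$ the convex hull. (A vector of $\mathbb{R}^n$ is identified with the corresponding constant function in $L_2$; distance is Euclidean distance in $\mathbb{R}^n$.) *)

(* Defs.v *)
From HB Require Import structures.
From mathcomp Require Import all_boot all_order all_algebra.
From mathcomp Require Import all_classical all_reals all_analysis.

Set Implicit Arguments.
Unset Strict Implicit.
Unset Printing Implicit Defensive.

Import Order.TTheory GRing.Theory Num.Theory.
Import numFieldNormedType.Exports.

Local Open Scope classical_set_scope.
Local Open Scope ring_scope.

Section Euclidean.
Context {R : realType} {n : nat}.
Implicit Types (u v : 'rV[R]_n) (A : set 'rV[R]_n).

Definition dotv u v : R := \sum_(i < n) u 0 i * v 0 i.

(* The library norm on row vectors is the sup norm, hence this one. *)
Definition enorm v : R := Num.sqrt (dotv v v).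

Definition conv_hull A : set 'rV[R]_n := smallest (@convex_set R 'rV[R]_n) A.

(* The infimum of the empty set is 0; only used for nonempty A. *)
Definition edist0 A : R := inf [set enorm v | v in A].

End Euclidean.

Section Differentiability.
Context {R : realType}.

(* On a finite-dimensional domain, continuity of all directional derivatives
   is continuity of the differential in operator norm. *)
Definition C1 (U W : normedModType R) (g : U -> W) : Prop :=
  (forall p, differentiable g p) /\ (forall v, continuous (fun p => 'D_v g p)).

Definition gradx n (Phi : 'rV[R]_n -> R -> R) (x : 'rV[R]_n) (t : R) :
    'rV[R]_n :=
  \row_(i < n) 'D_(delta_mx 0 i) (fun y => Phi y t) x.

(* The assumptions on f, required only on the domain R^n x V x [t0, T] on
   which the control system uses it. *)
Definition regular_dynamics n m (t0 T : R) (V : set 'rV[R]_m)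
    (f : 'rV[R]_n -> 'rV[R]_m -> R -> 'rV[R]_n) : Prop :=
  let D : set ('rV[R]_n * 'rV[R]_m * R) :=
    [set p | V p.1.2 /\ p.2 \in `[t0, T]] in
  [/\ forall x u t, D (x, u, t) -> differentiable (fun y => f y u t) x,
      exists L : R, forall u t, V u -> t \in `[t0, T] ->
        L.-lipschitz (fun y => f y u t),
      {within D, continuous (fun p => f p.1.1 p.1.2 p.2)} &
      {within D, continuous
        (fun p => jacobian (fun y => f y p.1.2 p.2) p.1.1)}].

End Differentiability.

Section Piecewise.
Context {R : realType} {n : nat}.
Implicit Types (a b : R) (g x z : R -> 'rV[R]_n).

(* Finitely many discontinuities, with finite one-sided limits everywhere;
   only the values on [a, b] matter. *)
Definition pw_continuous a b g : Prop :=
  [/\ exists s : seq R, forall t, t \in `]a, b[ -> t \notin s ->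
        {for t, continuous g},
      forall t, t \in `[a, b[ -> cvg (g y @[y --> t^'+]) &
      forall t, t \in `]a, b] -> cvg (g y @[y --> t^'-])].

(* x is piecewise continuously differentiable on [a, b] with derivative z. *)
Definition pw_derivative a b x z : Prop :=
  [/\ {within `[a, b], continuous x},
      pw_continuous a b z &
      exists s : seq R, forall t, t \in `]a, b[ -> t \notin s ->
        is_derive t 1 x (z t)].

(* x0 + \int_a^t z, the integral being taken componentwise. *)
Definition state_of a (x0 : 'rV[R]_n) z (t : R) : 'rV[R]_n :=
  x0 + \row_(i < n) (\int[lebesgue_measure]_(y in `[a, t]) z y 0 i).

Definition L2dist a b (g h : R -> 'rV[R]_n) : R :=
  Num.sqrt (\int[lebesgue_measure]_(t in `[a, b]) enorm (g t - h t) ^+ 2).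

End Piecewise.

Section L2topology.
Context {R : realType} {n m : nat}.
Implicit Types (a b : R) (p q : (R -> 'rV[R]_n) * (R -> 'rV[R]_m)).

Definition L2ball a b p (e : R) : set ((R -> 'rV[R]_n) * (R -> 'rV[R]_m)) :=
  [set q | [/\ pw_continuous a b q.1, pw_continuous a b q.2,
               L2dist a b p.1 q.1 < e & L2dist a b p.2 q.2 < e]].

(* Neighborhood filter of p for the L2 x L2 topology on the space of pairs of
   piecewise continuous functions on [a, b]. *)
Definition L2nbhs a b p : set_system ((R -> 'rV[R]_n) * (R -> 'rV[R]_m)) :=
  nbhs_ball_ (L2ball a b) p.

(* W is a neighborhood of the set A. *)
Definition L2nbhs_set a b (A W : set ((R -> 'rV[R]_n) * (R -> 'rV[R]_m))) :
  Prop := forall p, A p -> L2nbhs a b p W.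

End L2topology.

Section OptimalControl.
Context {R : realType} {n m : nat} {K : finType}.
Variables (t0 T : R) (x0 : 'rV[R]_n).
Variable f : 'rV[R]_n -> 'rV[R]_m -> R -> 'rV[R]_n.
Variable V : set 'rV[R]_m.
Variables (Phi0 : 'rV[R]_n -> R -> R) (Phi : K -> 'rV[R]_n -> R -> R).
Variables E I : {set K}.
Implicit Types (x z : R -> 'rV[R]_n) (u : R -> 'rV[R]_m) (xT : 'rV[R]_n).

Definition terminal_constraints xT : Prop :=
  (forall k, k \in E -> Phi k xT T = 0) /\
  (forall j, j \in I -> Phi j xT T <= 0).

(* As usual for piecewise continuous controls, the differential equation is
   required at all but finitely many times. *)
Definition satisfies_dynamics x z u : Prop :=
  exists s : seq R, forall t, t \in `[t0, T] -> t \notin s ->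
    z t = f (x t) (u t) t.

Definition admissible_control u : Prop :=
  pw_continuous t0 T u /\ forall t, t \in `[t0, T] -> V (u t).

Definition admissible_process x u : Prop :=
  [/\ exists2 z, pw_derivative t0 T x z & satisfies_dynamics x z u,
      admissible_control u, x t0 = x0 & terminal_constraints (x T)].

Definition optimal_pair x u : Prop :=
  admissible_process x u /\
  forall x' u', admissible_process x' u' -> Phi0 (x T) T <= Phi0 (x' T) T.

Definition final_state z : 'rV[R]_n := state_of t0 x0 z T.

(* The same admissible processes, parametrized by z = dx/dt. *)
Definition admissible_set : set ((R -> 'rV[R]_n) * (R -> 'rV[R]_m)) :=
  [set p | [/\ pw_continuous t0 T p.1,
               satisfies_dynamics (state_of t0 x0 p.1) p.1 p.2,
               admissible_control p.2 &
               terminal_constraints (final_state p.1)]].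

Definition CQ_free z : Prop :=
  free [seq gradx (Phi k) (final_state z) T | k in E].

Definition CQ_direction z : Prop :=
  exists d : 'rV[R]_n,
    (forall k, k \in E -> dotv (gradx (Phi k) (final_state z) T) d = 0) /\
    (forall j, j \in I -> dotv (gradx (Phi j) (final_state z) T) d < 0).

(* When E is nonempty, starting both maxima from 0 does not change the
   value, since the terms indexed by E are nonnegative. *)
Definition phi_term z : R :=
  Num.max (\big[Num.max/0]_(k in E) `|Phi k (final_state z) T|)
          (\big[Num.max/0]_(j in I) Phi j (final_state z) T).

Definition E_act z : set K :=
  [set k | k \in E /\ `|Phi k (final_state z) T| = phi_term z].

Definition I_act z : set K :=
  [set j | j \in I /\ Phi j (final_state z) T = phi_term z].

Definition subdiff_phi_term z : set 'rV[R]_n :=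
  conv_hull
    ([set Num.sg (Phi k (final_state z) T) *: gradx (Phi k) (final_state z) T
       | k in E_act z] `|`
     [set gradx (Phi j) (final_state z) T | j in I_act z]).

End OptimalControl.

(* Main.v *)
(* Since t0 < T are fixed, z |-> x(T) is continuous in L2, so it suffices to
   bound the subdifferential away from 0 for x near x*(T). Fix signs s_k = +-1
   for k in E. Linear independence of the equality gradients gives w with
   <grad Phi^k, w> = -2 s_k at x*(T), and for t large p = w + t d still
   satisfies this while making <grad Phi^j, p> <= -2 for all j in I. By
   continuity <., p> <= -1 holds near x*(T) on every generator
   s_k grad Phi^k, grad Phi^j, hence on their convex hull, whose distance to 0
   is thus at least 1 / (1 + |p|_1); only finitely many sign patterns occur. *)

Require Import Defs.
From mathcomp Require Import all_boot all_order all_algebra.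
From mathcomp Require Import all_classical all_reals all_analysis.
From mathcomp Require Import ring lra.

Set Implicit Arguments.
Unset Strict Implicit.
Unset Printing Implicit Defensive.

Import Order.TTheory GRing.Theory Num.Theory.
Import numFieldNormedType.Exports.

Local Open Scope classical_set_scope.
Local Open Scope ring_scope.

(** * Measurability and boundedness of scalar piecewise continuous functions *)

Section PiecewiseContinuous.
Context {R : realType}.
Implicit Types (a b t : R) (h : R -> R).

Lemma finite_set_measurable (D : set R) : finite_set D -> measurable D.
Proof.
by move=> finD; apply: countable_measurable => [t|];
  [exact: measurable_set1 | exact: finite_set_countable].
Qed.

Lemma finite_set_measurable_fun (D : set R) h :
  finite_set D -> measurable_fun D h.
Proof.
move=> finD _ Y mY; apply: finite_set_measurable.
by apply: sub_finite_set finD => x [].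
Qed.

(** Removing [s] from the open interval leaves an open set, on which continuity gives measurability.
    What remains of the segment is finite, and there every function is measurable. *)
Lemma measurable_fun_continuous_off_finite a b (s : seq R) h :
  (forall t, t \in `]a, b[ -> t \notin s -> {for t, continuous h}) ->
  measurable_fun `[a, b] h.
Proof.
move=> hs; set D := `]a, b[ `&` ~` [set` s].
have oD : open D.
  apply: openI; first exact: interval_open.
  apply: closed_openC; apply: (accessible_finite_set_closed.1 _).
    exact: hausdorff_accessible.
  exact: finite_seq.
apply: (@measurable_funS _ _ _ _ (D `|` [set` [:: a, b & s]])).
- apply: measurableU; first exact: measurable_realfun.open_measurable.
  by apply: finite_set_measurable; exact: finite_seq.
- move=> t /=; rewrite in_itv/= => /andP[at_ tb].
  have [ts|ts] := boolP (t \in [:: a, b & s]); first by right.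
  left; move: ts; rewrite !inE !negb_or => /and3P[ta tb' ts].
  split; last exact/negP.
  by rewrite /= in_itv/= !lt_neqAle at_ tb eq_sym ta tb'.
- apply/measurable_funU.
  + exact: measurable_realfun.open_measurable.
  + by apply: finite_set_measurable; exact: finite_seq.
  split; last by apply: finite_set_measurable_fun; exact: finite_seq.
  apply: measurable_realfun.open_continuous_measurable_fun => // t.
  by rewrite inE => -[tab /negP ts]; exact: hs.
Qed.

(** The limits at [t] bound [h] on each side of [t], the value [h t] is added by hand, and
    compactness of the segment turns these local bounds into one. *)
Lemma one_sided_limits_bounded a b h :
  (forall t, t \in `[a, b[ -> cvg (h y @[y --> t^'+])) ->
  (forall t, t \in `]a, b] -> cvg (h y @[y --> t^'-])) ->
  [bounded h t | t in `[a, b]].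
Proof.
move=> hr hl.
have near_bound (F : set_system R) : Filter F -> cvg (h y @[y --> F]) ->
    exists M, \forall y \near F, `|h y| <= M.
  move=> FF /cvg_ex[l hlF]; exists (`|l| + 1); near=> y.
  rewrite -[h y](subrK l) addrC (le_trans (ler_normD _ _))// lerD2l distrC.
  by near: y; move/cvgrPdist_le : hlF; apply.
suff : \forall M \near +oo, `[a, b] `<=` (fun t => `|h t| <= M) by [].
have /compact_near_coveringP/near_covering_withinP := @segment_compact R a b.
apply => t /=; rewrite in_itv/= => /andP[at_ tb].
have [Ml Mlh] : exists M, \forall y \near t, y < t -> a <= y -> `|h y| <= M.
  have [lat|p] := ltP a t.
    have [|M hM] := near_bound _ _ (hl t _); first by rewrite in_itv/= lat.
    by exists M; move: hM; apply: filterS => y hy _.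
  (* Here [t <= a], so no point of the segment lies to the left of [t] and any bound will do. *)
  exists 0; near=> y => yt ay.
  by move: (lt_le_trans yt (le_trans p ay)); rewrite ltxx.
have [Mr Mrh] : exists M, \forall y \near t, t < y -> y <= b -> `|h y| <= M.
  have [ltb|p] := ltP t b.
    have [|M hM] := near_bound _ _ (hr t _); first by rewrite in_itv/= ltb at_.
    by exists M; move: hM; apply: filterS => y hy _.
  exists 0; near=> y => ty yb.
  by move: (lt_le_trans ty (le_trans yb p)); rewrite ltxx.
near=> y M => /=; rewrite in_itv/= => /andP[ay yb].
have [yt|ty|->] := ltgtP y t.
- apply: (@le_trans _ _ Ml); last first.
    by near: M; exact: nbhs_pinfty_ge (num_real _).
  by move: yt ay; near: y.
- apply: (@le_trans _ _ Mr); last first.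
    by near: M; exact: nbhs_pinfty_ge (num_real _).
  by move: ty yb; near: y.
- by near: M; exact: nbhs_pinfty_ge (num_real _).
Unshelve. all: by end_near. Qed.

End PiecewiseContinuous.

(** * Integrability of the coordinates of piecewise continuous vector functions *)

Section PiecewiseContinuousVector.
Context {R : realType} {n : nat}.
Implicit Types (a b : R) (g : R -> 'rV[R]_n).

Local Notation mu := (@lebesgue_measure R).

Lemma pw_continuous_measurable a b g (i : 'I_n) :
  pw_continuous a b g -> measurable_fun `[a, b] (fun t => g t 0 i).
Proof.
move=> [[s hs] _ _]; apply: (measurable_fun_continuous_off_finite (s := s)).
move=> t tab ts; apply: (@continuous_comp _ _ _ g (fun M : 'rV_n => M 0 i)).
  exact: hs.
exact: coord_continuous.
Qed.

Lemma pw_continuous_bounded a b g (i : 'I_n) :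
  pw_continuous a b g -> [bounded g t 0 i | t in `[a, b]].
Proof.
have cvg_coord (F : set_system R) : Filter F -> cvg (g y @[y --> F]) ->
    cvg (g y 0 i @[y --> F]).
  move=> FF /cvg_ex[l gl]; apply/cvg_ex; exists (l 0 i).
  apply: (@cvg_comp _ _ _ g (fun M : 'rV[R]_n => M 0 i) F (nbhs l)) => //.
  exact: coord_continuous.
by move=> [_ gr gl]; apply: one_sided_limits_bounded => t /[dup] ? ?;
   apply: cvg_coord; [exact: gr | exact: gl].
Qed.

Lemma lebesgue_measure_segment_lty a b : (mu `[a, b] < +oo)%E.
Proof.
by rewrite lebesgue_measure_itv/=; case: ifP => // _; rewrite -EFinB ltry.
Qed.

Lemma pw_continuous_integrable a b g (i : 'I_n) :
  pw_continuous a b g -> mu.-integrable `[a, b] (EFin \o (fun t => g t 0 i)).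
Proof.
move=> pg; apply: measurable_bounded_integrable => //.
- exact: lebesgue_measure_segment_lty.
- exact: pw_continuous_measurable.
- exact: pw_continuous_bounded.
Qed.

Lemma pw_continuous_sqdist_integrable a b g g' (i : 'I_n) :
  pw_continuous a b g -> pw_continuous a b g' ->
  mu.-integrable `[a, b] (EFin \o (fun t => (g t 0 i - g' t 0 i) ^+ 2)).
Proof.
move=> pg pg'; apply: measurable_bounded_integrable => //.
- exact: lebesgue_measure_segment_lty.
- apply: measurable_realfun.measurable_funX.
  by apply: measurable_realfun.measurable_funB; exact: pw_continuous_measurable.
(* Boundedness says that every number above [M] is a bound; [M + 1] is one such number. *)
- have [M [_ /(_ (M + 1))]] := pw_continuous_bounded i pg.
  rewrite ltrDl ltr01 => /(_ isT) gM.
  have [M' [_ /(_ (M' + 1))]] := pw_continuous_bounded i pg'.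
  rewrite ltrDl ltr01 => /(_ isT) gM'.
  exists ((M + 1 + (M' + 1)) ^+ 2); split; first exact: num_real.
  move=> x /ltW Mx t tab /=; apply: le_trans Mx; rewrite normrX.
  have dM : `|g t 0 i - g' t 0 i| <= M + 1 + (M' + 1).
    by rewrite (le_trans (ler_normB _ _))// lerD ?gM ?gM'.
  by rewrite lerXn2r ?nnegrE// (le_trans _ dM).
Qed.

End PiecewiseContinuousVector.

(** * Functions with zero derivative off a finite set *)

Section FTC.
Context {R : realType}.
Implicit Types (a b t : R) (h : R -> R).

(** Induction on the exceptional points: a point inside the interval splits it into two intervals
    with fewer exceptions, a point outside is dropped. Continuity at the splitting point glues the
    halves; without exceptions this is the mean value theorem. *)
Lemma constant_off_finite (s : seq R) h a b : a <= b ->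
  {within `[a, b], continuous h} ->
  (forall t, t \in `]a, b[ -> t \notin s -> is_derive t 1 h 0) -> h b = h a.
Proof.
elim: s a b => [|p s IH] a b ab hc hd.
  have [t tab|c _] := MVT_segment (df := cst 0) ab _ hc; first exact: hd.
  by rewrite mul0r => /eqP; rewrite subr_eq0 => /eqP.
have [pab|pab] := boolP (p \in `]a, b[); last first.
  apply: IH => // t tab ts; apply: hd => //.
  by rewrite inE (negbTE ts) orbF; apply: contraNneq pab => <-.
have /andP[ap pb] : a < p < b by move: pab; rewrite in_itv.
have ap' : a <= p by exact: ltW.
have pb' : p <= b by exact: ltW.
have hcl : {within `[a, p], continuous h}.
  have : `[a, p] `<=` `[a, b] by apply: subset_itvl; rewrite bnd_simp.
  by move/continuous_subspaceW; apply; exact: hc.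
have hcr : {within `[p, b], continuous h}.
  have : `[p, b] `<=` `[a, b] by apply: subset_itvr; rewrite bnd_simp.
  by move/continuous_subspaceW; apply; exact: hc.
have hdl t : t \in `]a, p[ -> t \notin s -> is_derive t 1 h 0.
  rewrite in_itv/= => /andP[at_ tp] ts; apply: hd.
    by rewrite in_itv/= at_ (lt_trans tp).
  by rewrite inE negb_or ts lt_eqF.
have hdr t : t \in `]p, b[ -> t \notin s -> is_derive t 1 h 0.
  rewrite in_itv/= => /andP[pt tb] ts; apply: hd.
    by rewrite in_itv/= tb (lt_trans ap).
  by rewrite inE negb_or ts gt_eqF.
by rewrite (IH p b pb' hcr hdr) (IH a p ap' hcl hdl).
Qed.

End FTC.

(** * The state as a function of its derivative, and its continuity in L2 *)

Section State.
Context {R : realType} {n : nat}.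
Implicit Types (a b t : R) (x z : R -> 'rV[R]_n).
Local Notation mu := (@lebesgue_measure R).

(** Each coordinate of [x] minus the primitive of [z] is continuous with zero derivative off a
    finite set, hence constant. This identifies the trajectory with its parametrization by the
    derivative. *)
Lemma pw_derivative_state_of a b x z t : pw_derivative a b x z ->
  t \in `[a, b] -> state_of a (x a) z t = x t.
Proof.
move=> [xc pz [s hs]]; rewrite in_itv/= => /andP[at_ tb].
apply/rowP => i; rewrite !mxE.
have [[s' hs'] _ _] := pz.
have iz := pw_continuous_integrable i pz.
pose P := fun t => parameterized_integral mu a t (fun y => z y 0 i).
pose h t := x t 0 i - P t.
have subab : `[a, t] `<=` `[a, b] by apply: subset_itvl; rewrite bnd_simp.
have hta : h t = h a.
  (* Outside [s] the derivative of [x] is [z]; outside [s'] the function [z] is continuous, as the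
     fundamental theorem of calculus requires. *)
  apply: (@constant_off_finite _ (s ++ s') _ _ _ at_).
    apply: continuous_subspaceW subab _ => u.
    apply: cvgB; last first.
      exact: (parameterized_integral_continuous (le_trans at_ tb) iz).
    by apply: (@cvg_comp _ _ _ x (fun M : 'rV[R]_n => M 0 i));
      [exact: xc|exact: coord_continuous].
  move=> u; rewrite in_itv/= => /andP[au ut].
  rewrite mem_cat negb_or => /andP[us us'].
  have uab : u \in `]a, b[ by rewrite in_itv/= au (lt_le_trans ut).
  rewrite -(subrr (z u 0 i)); apply: is_deriveB.
    have [dx xz] := hs _ uab us.
    split; first exact: (derivable_mxP _ _ _).1.
    by rewrite -xz derive_mx// mxE.
  have [||||dP PE] := @continuous_FTC1 _ (fun y => z y 0 i) (BLeft a) u b.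
  - by rewrite (lt_le_trans ut).
  - exact: iz.
  - by rewrite lte_fin.
  - apply: (@continuous_comp _ _ _ z (fun M : 'rV_n => M 0 i)).
      exact: hs'.
    exact: coord_continuous.
  by split; [exact: dP | rewrite -derive1E; exact: PE].
move: hta; rewrite /h {2}/P /parameterized_integral set_itv1 Rintegral_set1.
by rewrite subr0 => <-; rewrite subrK.
Qed.

(* The integrand bound is AM-GM, [|u| <= (c + u^2 / c) / 2]. *)
Lemma state_of_dist a b (x0 : 'rV[R]_n) z z' (i : 'I_n) (c : R) :
  a <= b -> 0 < c -> pw_continuous a b z -> pw_continuous a b z' ->
  `|state_of a x0 z b 0 i - state_of a x0 z' b 0 i| <=
    (c * (b - a) + c^-1 * L2dist a b z z' ^+ 2) / 2.
Proof.
move=> ab c0 pz pz'; rewrite !mxE opprD addrACA subrr add0r.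
have iz := pw_continuous_integrable i pz.
have iz' := pw_continuous_integrable i pz'.
have isq j := pw_continuous_sqdist_integrable j pz pz'.
have mab : measurable (`[a, b] : set R) by exact: measurable_itv.
have muab : fine (mu `[a, b]) = b - a.
  rewrite lebesgue_measure_itv/= lte_fin.
  by move: ab; rewrite le_eqVlt => /predU1P[->|->]; rewrite ?ltxx ?subrr.
have izz' : mu.-integrable `[a, b] (EFin \o (fun y => z y 0 i - z' y 0 i)).
  by apply: eq_integrable (integrableB _ iz iz').
have mul_int (k : R) f : mu.-integrable `[a, b] (EFin \o f) ->
   mu.-integrable `[a, b] (EFin \o (fun y => k * f y)).
  by move=> fi; apply: eq_integrable (integrableZl _ k fi).
have add_int f g : mu.-integrable `[a, b] (EFin \o f) ->
   mu.-integrable `[a, b] (EFin \o g) ->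
   mu.-integrable `[a, b] (EFin \o (fun y => f y + g y)).
  by move=> fi gi; apply: eq_integrable (integrableD _ fi gi).
have icst : mu.-integrable `[a, b] (EFin \o (fun=> c)).
  apply: measurable_bounded_integrable => //.
    exact: lebesgue_measure_segment_lty.
  exact: bounded_cst.
rewrite -RintegralB//; apply: le_trans (le_normr_Rintegral _ izz') _ => //.
have enormE y : enorm (z y - z' y) ^+ 2 = \sum_j (z y 0 j - z' y 0 j) ^+ 2.
  rewrite sqr_sqrtr; last by apply: sumr_ge0 => j _; rewrite -expr2 sqr_ge0.
  by apply: eq_bigr => j _; rewrite !mxE expr2.
have isum : mu.-integrable `[a, b] (EFin \o (fun y => enorm (z y - z' y) ^+ 2)).
  have := @integrable_sum _ _ _ mu _ mab _ (index_enum 'I_n) xpredT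
    (fun j y => ((z y 0 j - z' y 0 j) ^+ 2)%:E) (fun j _ => isq j).
  by apply: eq_integrable => // y _ /=; rewrite enormE sumEFin.
rewrite sqr_sqrtr; last by apply: Rintegral_ge0 => y _; rewrite sqr_ge0.
set N := fun y => enorm (z y - z' y) ^+ 2 in isum *.
(* The bound is itself the integral of the AM-GM majorant, so only a pointwise inequality
   remains. *)
have -> : (c * (b - a) + c^-1 * \int[mu]_(t in `[a, b]) N t) / 2
   = \int[mu]_(t in `[a, b]) (2^-1 * (c + c^-1 * N t)).
  have icN := mul_int c^-1 _ isum.
  rewrite RintegralZl//; last exact: add_int.
  rewrite RintegralD// RintegralZl// Rintegral_cst//.
  by rewrite [fine _]muab mulrC.
apply: le_Rintegral => //.
- exact: integrable_norm izz'.
- by apply: (mul_int); apply: add_int => //; exact: mul_int.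
- move=> y _; rewrite /N enormE.
  set u := z y 0 i - z' y 0 i.
  have uN : u ^+ 2 <= \sum_j (z y 0 j - z' y 0 j) ^+ 2.
    by rewrite (bigD1 i)//= lerDl sumr_ge0// => j _; rewrite sqr_ge0.
  have uc : 2 * `|u| <= c + c^-1 * u ^+ 2.
    have -> : c + c^-1 * u ^+ 2 = 2 * `|u| + c^-1 * (c - `|u|) ^+ 2.
      by rewrite -[u ^+ 2]real_normK ?num_real//; field; rewrite gt_eqF.
    by rewrite lerDl mulr_ge0 ?sqr_ge0 ?invr_ge0 ?ltW.
  have cN := ler_wpM2l (ltW (_ : 0 < c^-1)) uN; rewrite invr_gt0 in cN.
  by move: uc (cN c0); lra.
Qed.

(** The free parameter of [state_of_dist] does the work of Cauchy-Schwarz: it is tuned to the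
    accuracy [d]. The norm is the sup norm, so coordinatewise bounds suffice. *)
Lemma state_of_continuous_L2 a b (x0 : 'rV[R]_n) z (d : R) :
  a < b -> 0 < d -> pw_continuous a b z ->
  exists2 e, 0 < e & forall z', pw_continuous a b z' -> L2dist a b z z' < e ->
    `|state_of a x0 z b - state_of a x0 z' b| < d.
Proof.
move=> ab d0 pz; have ba0 : 0 < b - a by rewrite subr_gt0.
(* The first term of the bound becomes [d / 2], and an L2 distance below [Num.sqrt (c * d)] keeps
   the second below [d / 2]. *)
pose c := d / (b - a); have c0 : 0 < c by rewrite divr_gt0.
exists (Num.sqrt (c * d)) => [|z' pz' zz']; first by rewrite sqrtr_gt0 mulr_gt0.
rewrite [ltLHS]/Num.Def.normr/= mx_normrE; apply: bigmax_lt => // -[i0 i] _ /=.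
rewrite ord1 mxE [X in _ + X]mxE.
apply: le_lt_trans (state_of_dist x0 i (ltW ab) c0 pz pz') _.
rewrite ltr_pdivrMr// mulr_natr mulr2n /c divfK ?gt_eqF// ltrD2l mulrC.
rewrite ltr_pdivrMr// mulrC -[ltRHS]sqr_sqrtr ?ltrXn2r ?nnegrE ?sqrtr_ge0//.
by rewrite mulr_ge0 // ltW.
Qed.

End State.

(** * Dot products, half-spaces and the distance from 0 to a convex hull *)

Section DotProduct.
Context {R : realType} {n : nat}.
Implicit Types (u v w : 'rV[R]_n) (c : R).

Lemma dotvDl u v w : dotv (u + v) w = dotv u w + dotv v w.
Proof. by rewrite -big_split; apply: eq_bigr => i _; rewrite mxE mulrDl. Qed.

Lemma dotvDr u v w : dotv u (v + w) = dotv u v + dotv u w.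
Proof. by rewrite -big_split; apply: eq_bigr => i _; rewrite mxE mulrDr. Qed.

Lemma dotvZl c u v : dotv (c *: u) v = c * dotv u v.
Proof. by rewrite mulr_sumr; apply: eq_bigr => i _; rewrite mxE mulrA. Qed.

Lemma dotvZr c u v : dotv u (c *: v) = c * dotv u v.
Proof. by rewrite mulr_sumr; apply: eq_bigr => i _; rewrite mxE mulrCA. Qed.

Lemma coord_le_enorm u i : `|u 0 i| <= enorm u.
Proof.
rewrite -sqrtr_sqr ler_wsqrtr// /dotv (bigD1 i)//= -expr2 lerDl.
by apply: sumr_ge0 => j _; rewrite -expr2 sqr_ge0.
Qed.

(** Each coordinate of [u] is at most [enorm u]. This bound, coarser than Cauchy-Schwarz, is enough
    to make distances positive. *)
Lemma normr_dotv_le u v : `|dotv u v| <= enorm u * \sum_i `|v 0 i|.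
Proof.
rewrite mulr_sumr; apply: le_trans (ler_norm_sum _ _ _) _.
apply: ler_sum => i _; rewrite normrM.
by apply: ler_wpM2r; [exact: normr_ge0 | exact: coord_le_enorm].
Qed.

(** A half-space is convex, and the hull is the smallest convex set containing [A]. *)
Lemma conv_hull_halfspace (A : set 'rV[R]_n) (p : 'rV[R]_n) (c : R) :
  (forall v, A v -> dotv v p <= c) ->
  forall v, conv_hull A v -> dotv v p <= c.
Proof.
move=> Ap; apply: (@smallest_sub _ _ A [set v | dotv v p <= c]) => //.
move=> u v l; rewrite !inE /= => uc vc.
have -> : conv l u v = l%:num *: u + (1 - l%:num) *: v by [].
rewrite dotvDl !dotvZl.
have l0 : 0 <= l%:num by [].
have l1 : 0 <= 1 - l%:num by rewrite subr_ge0.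
have := ler_wpM2l l0 uc; have := ler_wpM2l l1 vc.
by nra.
Qed.

(** On the hull, [1 <= - dotv v p], which is at most [enorm v] times the l1 norm of [p]. The added 1
    keeps the denominator positive without a discussion of [p]; nonemptiness matters because the
    infimum of the empty set is 0. *)
Lemma edist0_halfspace (A : set 'rV[R]_n) (p : 'rV[R]_n) :
  A !=set0 -> (forall v, A v -> dotv v p <= -1) ->
  (1 + \sum_i `|p 0 i|)^-1 <= edist0 (conv_hull A).
Proof.
move=> [u Au] Ap; apply: lb_le_inf.
  by exists (enorm u), u => //; exact: sub_gen_smallest.
move=> _ [v Av <-].
have := conv_hull_halfspace Ap Av; have := normr_dotv_le v p.
have sp0 : 0 <= \sum_i `|p 0 i| by apply: sumr_ge0.
have v0 : 0 <= enorm v by rewrite sqrtr_ge0.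
rewrite -div1r ler_pdivrMr; last by rewrite ltr_pwDl.
have := ler_norm (- dotv v p); rewrite normrN.
by nra.
Qed.

End DotProduct.

(** * Separating vectors, uniformly in signs and active sets *)

Section Separation.
Context {R : realType} {n : nat} {K : finType}.
Implicit Types (g : K -> 'rV[R]_n) (E I : {set K}).

(** The matrix [M] with rows [g k] has full row rank, hence a right inverse [B], and [B] applied to
    the column of prescribed values solves the system. *)
Lemma free_dotv_surjective g E (c : K -> R) :
  free [seq g k | k in E] ->
  exists w, forall k, k \in E -> dotv (g k) w = c k.
Proof.
move=> gfree; pose M := \matrix_(j < #|E|) g (enum_val j).
have /row_freeP[B MB] : row_free M.
  apply: inj_row_free => v vM; apply/rowP => j; rewrite mxE.
  have := @freeP _ _ _ (image_tuple g E) gfree (v 0) _ j; apply.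
  rewrite -[RHS]vM mulmx_sum_row; apply: eq_bigr => i _.
  by rewrite rowK (nth_image 0).
pose C := \col_(j < #|E|) c (enum_val j).
exists (B *m C)^T => k kE; pose j := enum_rank_in kE k.
have jk : enum_val j = k by exact: enum_rankK_in.
transitivity ((M *m (B *m C)) j 0).
  by rewrite !mxE; apply: eq_bigr => i _; rewrite !mxE jk.
by rewrite mulmxA MB mul1mx mxE jk.
Qed.

Lemma separating_vector g E I (s : K -> R) (d : 'rV[R]_n) :
  free [seq g k | k in E] ->
  (forall k, k \in E -> dotv (g k) d = 0) ->
  (forall j, j \in I -> dotv (g j) d < 0) ->
  exists p, (forall k, k \in E -> dotv (g k) p = s k) /\
            (forall j, j \in I -> dotv (g j) p <= -2).
Proof.
move=> gfree gd0 gdlt0; have [w gw] := free_dotv_surjective s gfree.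
(* Each [dotv (g j) d] is negative, so every [j] only asks for [t] to be large; finiteness of [K]
   gives a common [t]. *)
have /filter_ex[t ht] : \forall t \near +oo, forall j : K, j \in I ->
    dotv (g j) w + t * dotv (g j) d <= -2.
  apply: filter_forall => j; near=> t => jI; have gj := gdlt0 j jI.
  have : (- 2 - dotv (g j) w) / dotv (g j) d <= t.
    by near: t; exact: nbhs_pinfty_ge (num_real _).
  by rewrite ler_ndivrMr// lerBrDl.
exists (w + t *: d); split=> [k kE|j jI]; rewrite dotvDr dotvZr.
  by rewrite gd0// mulr0 addr0 gw.
exact: ht.
Unshelve. all: by end_near. Qed.

(** Signs and active sets may jump as [x] varies, so they are quantified after the neighborhood and
    the constant, with only inclusion in [E] and [I] kept. *)
Lemma signed_hulls_bounded_away (X : topologicalType) (G : K -> X -> 'rV[R]_n)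
    E I (xs : X) (d : 'rV[R]_n) :
  (forall k, k \in E :|: I -> forall p,
    {for xs, continuous (fun x => dotv (G k x) p)}) ->
  free [seq G k xs | k in E] ->
  (forall k, k \in E -> dotv (G k xs) d = 0) ->
  (forall j, j \in I -> dotv (G j xs) d < 0) ->
  exists2 a, 0 < a & \forall x \near xs,
    forall (sg : K -> bool) (A B : set K),
      A `<=` [set` E] -> B `<=` [set` I] -> A `|` B !=set0 ->
      a <= edist0 (conv_hull ([set (-1) ^+ sg k *: G k x | k in A] `|`
                              [set G j x | j in B])).
Proof.
move=> Gc Gfree Gd0 Gdlt0;
(* Sign patterns are finite functions, so that finitely many neighborhoods are intersected. The
   value -2 leaves room to stay below -1 near [xs]. *)
have /choice[p pP] : forall f : {ffun K -> bool}, exists p,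
    (forall k, k \in E -> dotv (G k xs) p = (-1) ^+ f k * -2) /\
    (forall j, j \in I -> dotv (G j xs) p <= -2).
  by move=> f; exact: (separating_vector _ Gfree Gd0 Gdlt0).
pose N f := \sum_i `|p f 0 i|.
have N0 f : 0 <= N f by apply: sumr_ge0.
(* The sum over all patterns dominates each [N f], so this constant is below every
   [(1 + N f)^-1]. *)
exists (1 + \sum_f N f)^-1; first by rewrite invr_gt0 ltr_pwDl// sumr_ge0.
have nearE : \forall x \near xs, forall (f : {ffun K -> bool}) k, k \in E ->
    (-1) ^+ f k * dotv (G k x) (p f) <= -1.
  apply: filter_forall => f.
  apply: filter_forall => k.
  have [kE|kE] := boolP (k \in E); last by near=> x.
  have kEI : k \in E :|: I by rewrite inE kE.
  have : (-1) ^+ f k * dotv (G k xs) (p f) < -1.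
    by rewrite (pP f).1// mulrA -signr_addb addbb mul1r ltrN2 ltr1n.
  have Gkc : (-1) ^+ f k * dotv (G k x) (p f) @[x --> xs] -->
      (-1) ^+ f k * dotv (G k xs) (p f).
    by apply: cvgM; [exact: cvg_cst | exact: Gc].
  move/(@cvgr_lt R _ (nbhs xs) _ _ _ Gkc).
  by apply: filterS => x /ltW.
have nearI : \forall x \near xs, forall (f : {ffun K -> bool}) j, j \in I ->
    dotv (G j x) (p f) <= -1.
  apply: filter_forall => f.
  apply: filter_forall => j.
  have [jI|jI] := boolP (j \in I); last by near=> x.
  have jEI : j \in E :|: I by rewrite inE jI orbT.
  have : dotv (G j xs) (p f) < -1.
    by apply: le_lt_trans ((pP f).2 j jI) _; rewrite ltrN2 ltr1n.
  move/(@cvgr_lt R _ (nbhs xs) _ _ _ (Gc j jEI (p f))).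
  by apply: filterS => x /ltW.
near=> x => sg A B AE BI AB0.
pose f := [ffun k => sg k].
have NfN : N f <= \sum_f N f.
  by rewrite (bigD1 f)//= lerDl sumr_ge0.
apply: (@le_trans _ _ (1 + N f)^-1).
  by rewrite lef_pV2 ?posrE ?ltr_pwDl ?lerD2l// sumr_ge0.
apply: edist0_halfspace.
  have [k [Ak|Bk]] := AB0.
    by exists ((-1) ^+ sg k *: G k x); left; exists k.
  by exists (G k x); right; exists k.
move=> _ [[k Ak <-]|[j Bj <-]].
  have kE : k \in E by exact: AE.
  have := near nearE x; move=> /(_ _ f k kE).
  by rewrite ffunE dotvZl; apply.
have jI : j \in I by exact: BI.
by have := near nearI x; move=> /(_ _ f j jI); apply.
Unshelve. all: by end_near. Qed.

End Separation.

(** * Continuity of the spatial gradient *)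

Section Gradient.
Context {R : realType} {n : nat}.

Lemma continuous_pair_cst (X Y : topologicalType) (y : Y) :
  continuous (fun x : X => (x, y)).
Proof. by move=> x; apply: cvg_pair; [exact: cvg_id | exact: cvg_cst]. Qed.

Lemma continuous_linear_combination (X : topologicalType) (F : 'I_n -> X -> R)
    (c : 'I_n -> R) :
  (forall i, continuous (F i)) -> continuous (fun x => \sum_i F i x * c i).
Proof.
move=> Fc x; elim: (index_enum _) => [|i r IHr].
  rewrite (_ : (fun _ => _) = cst 0); first exact: cst_continuous.
  by apply/funext => y; rewrite big_nil.
rewrite (_ : (fun _ => _) = (fun y => F i y * c i + \sum_(j <- r) F j y * c j)).
  by apply: cvgD IHr; apply: cvgM; [exact: Fc | exact: cvg_cst].
by apply/funext => y; rewrite big_cons.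
Qed.

(** The i-th partial derivative at fixed time is the derivative of the joint function in the
    direction [(delta_mx 0 i, 0)], which is continuous by [C1]. *)
Lemma gradx_dotv_continuous (Phi : 'rV[R]_n -> R -> R) (t : R) (p : 'rV[R]_n) :
  C1 (fun q : 'rV[R]_n * R => Phi q.1 q.2) ->
  continuous (fun x => dotv (gradx Phi x t) p).
Proof.
move=> [_ Phic] x.
have -> : (fun x => dotv (gradx Phi x t) p) = (fun x => \sum_(i < n)
    'D_((delta_mx 0 i : 'rV[R]_n), 0 : R) (fun q => Phi q.1 q.2) (x, t) *
    p 0 i).
  apply/funext => y; apply: eq_bigr => i _; rewrite mxE; congr (_ * _).
  rewrite /derive; set F := fun h : R => _; set F' := fun h : R => _.
  by have -> : F = F' by apply/funext => h; rewrite /F /F' /= scaler0 add0r.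
apply: (@continuous_linear_combination 'rV[R]_n (fun i x =>
  'D_((delta_mx 0 i : 'rV[R]_n), 0 : R) (fun q => Phi q.1 q.2) (x, t)) (p 0)).
move=> i {}x.
exact: (continuous_comp (@continuous_pair_cst 'rV[R]_n R t x)
  (Phic (delta_mx 0 i, 0) (x, t))).
Qed.

End Gradient.

(** * Active indices and the form of the subdifferential *)

Lemma bigmax_attained (R : realType) (K : finType) (A : {set K}) (F : K -> R) :
  0 < \big[Num.max/0]_(k in A) F k ->
  exists2 k, k \in A & F k = \big[Num.max/0]_(k in A) F k.
Proof.
(* Positivity excludes the default value 0, so the maximum is reached at an index. *)
move=> M0; have /bigmax_geP[|[k kA Mk]] := lexx (\big[Num.max/0]_(k in A) F k).
  by rewrite leNgt M0.
by exists k => //; apply/eqP; rewrite eq_le Mk le_bigmax_cond.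
Qed.

Section Subdifferential.
Context {R : realType} {n : nat} {K : finType}.
Context (t0 T : R) (x0 : 'rV[R]_n) (Phi : K -> 'rV[R]_n -> R -> R).
Context (E I : {set K}).
Implicit Types z : R -> 'rV[R]_n.

(** The larger of the two maxima equals [phi_term], is positive, and is therefore attained. *)
Lemma act_neq0 z : 0 < phi_term t0 T x0 Phi E I z ->
  E_act t0 T x0 Phi E I z `|` I_act t0 T x0 Phi E I z !=set0.
Proof.
pose ME := \big[Num.max/0]_(k in E) `|Phi k (final_state t0 T x0 z) T|.
pose MI := \big[Num.max/0]_(j in I) Phi j (final_state t0 T x0 z) T.
have phiM : phi_term t0 T x0 Phi E I z = Num.max ME MI by [].
rewrite phiM; have [leEI|ltIE] := leP ME MI; move=> /bigmax_attained[k kA Fk].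
  by exists k; right; split => //; rewrite Fk phiM; apply/esym/max_idPr.
by exists k; left; split => //; rewrite Fk phiM; apply/esym/max_idPl/ltW.
Qed.

(** An active equality index has [Phi k] nonzero, its absolute value being [phi_term], so its sign
    is a power of -1, as [signed_hulls_bounded_away] expects. *)
Lemma subdiff_signed_gradients z : 0 < phi_term t0 T x0 Phi E I z ->
  let x := final_state t0 T x0 z in
  subdiff_phi_term t0 T x0 Phi E I z =
  conv_hull
    ([set (-1) ^+ (Phi k x T < 0)%R *: gradx (Phi k) x T
       | k in E_act t0 T x0 Phi E I z] `|`
     [set gradx (Phi j) x T | j in I_act t0 T x0 Phi E I z]).
Proof.
move=> phi0 x; congr (conv_hull (_ `|` _)); apply: eq_imagel => k [_ phik].
by rewrite neqr0_sign// -normr_gt0 phik.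
Qed.

End Subdifferential.

(** * The optimal pair in the parametrization by the derivative *)

Lemma star_admissible (R : realType) (n m : nat) (K : finType) (E I : {set K})
    (t0 T : R) (x0 : 'rV[R]_n)
    (f : 'rV[R]_n -> 'rV[R]_m -> R -> 'rV[R]_n) (V : set 'rV[R]_m)
    (Phi : K -> 'rV[R]_n -> R -> R) (x z : R -> 'rV[R]_n) (u : R -> 'rV[R]_m) :
  t0 <= T -> admissible_process t0 T x0 f V Phi E I x u ->
  pw_derivative t0 T x z -> admissible_set t0 T x0 f V Phi E I (z, u).
Proof.
move=> t0T [[z' xz' [s dyn]] uV xt0 xT] xz.
have stE t : t \in `[t0, T] -> state_of t0 x0 z t = x t.
  by rewrite -xt0; exact: pw_derivative_state_of.
have [_ pz [s1 xz1]] := xz; have [_ _ [s2 xz2]] := xz'.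
split => //=; last first.
  by rewrite /final_state stE// in_itv/= t0T lexx.
(* The dynamics are known for some derivative [z'] of [x]. Away from the endpoints and from [s1] and
   [s2], both [z] and [z'] are the derivative of [x], hence agree; [s] holds the exceptions to the
   dynamics. *)
exists (t0 :: T :: s1 ++ s2 ++ s) => t tT; rewrite !inE !mem_cat !negb_or.
move=> /and5P[tt0 tT' ts1 ts2 ts]; rewrite stE// -(dyn _ tT ts).
have tT1 : t \in `]t0, T[.
  by move: tT; rewrite !in_itv/= !lt_neqAle eq_sym tt0 tT'.
have [_ <-] := xz1 t tT1 ts1.
by have [_ <-] := xz2 t tT1 ts2.
Qed.

(** Places [(zstar, ustar)] in its own neighborhoods. Balls contain only piecewise continuous pairs,
    whence the two hypotheses on [p]. *)
Lemma L2ball_center (R : realType) (n m : nat) (a b : R)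
    (p : (R -> 'rV[R]_n) * (R -> 'rV[R]_m)) (e : R) : 0 < e ->
  pw_continuous a b p.1 -> pw_continuous a b p.2 -> L2ball a b p e p.
Proof.
have L2dist_refl k (g : R -> 'rV[R]_k) : L2dist a b g g = 0.
  rewrite /L2dist (_ : (fun t => _) = cst 0); last first.
    apply/funext => t; rewrite sqr_sqrtr.
      by apply: big1 => i _; rewrite !mxE subrr mul0r.
    by apply: sumr_ge0 => i _; rewrite -expr2 sqr_ge0.
  by rewrite Rintegral_cst// mul0r sqrtr0.
by move=> e0 p1 p2; split; rewrite ?L2dist_refl.
Qed.

(** * From neighborhoods of the final state to L2 neighborhoods of the optimal pair *)

Theorem mainTheorem4 (R : realType) (n m : nat) (K : finType) (E I : {set K})
    (t0 T : R) (x0 : 'rV[R]_n)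
    (f : 'rV[R]_n -> 'rV[R]_m -> R -> 'rV[R]_n) (V : set 'rV[R]_m)
    (Phi0 : 'rV[R]_n -> R -> R) (Phi : K -> 'rV[R]_n -> R -> R)
    (xstar zstar : R -> 'rV[R]_n) (ustar : R -> 'rV[R]_m)
    (t0_lt_T : t0 < T)
    (E_neq0 : E != finset.set0) (I_neq0 : I != finset.set0)
    (EI_disjoint : E :&: I = finset.set0)
    (V_compact : compact V)
    (f_regular : regular_dynamics t0 T V f)
    (Phi0_C1 : C1 (fun p : 'rV[R]_n * R => Phi0 p.1 p.2))
    (Phi_C1 : forall k, k \in E :|: I ->
      C1 (fun p : 'rV[R]_n * R => Phi k p.1 p.2))
    (star_optimal : optimal_pair t0 T x0 f V Phi0 Phi E I xstar ustar)
    (star_active : forall k, k \in E :|: I -> Phi k (xstar T) T = 0)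
    (zstar_derivative : pw_derivative t0 T xstar zstar)
    (CQ : exists W : set ((R -> 'rV[R]_n) * (R -> 'rV[R]_m)),
      L2nbhs_set t0 T (admissible_set t0 T x0 f V Phi E I) W /\
      forall z u, W (z, u) ->
        CQ_free t0 T x0 Phi E z /\ CQ_direction t0 T x0 Phi E I z) :
  exists (B : set ((R -> 'rV[R]_n) * (R -> 'rV[R]_m))) (a : R),
    [/\ L2nbhs t0 T (zstar, ustar) B, 0 < a &
        forall z u, B (z, u) -> 0 < phi_term t0 T x0 Phi E I z ->
          a <= edist0 (subdiff_phi_term t0 T x0 Phi E I z)].
Proof.
have [adm _] := star_optimal.
have admz := star_admissible (ltW t0_lt_T) adm zstar_derivative.
have [pz _ [pu _] _] := admz.
have [W [Wn CQW]] := CQ.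
have [e0 /= e0_gt0 e0W] := Wn _ admz.
(* The pair [(zstar, ustar)] is admissible, hence lies in [W], which gives both constraint
   qualifications there. *)
have [Gfree [d [Gd0 Gdlt0]]] : CQ_free t0 T x0 Phi E zstar /\
    CQ_direction t0 T x0 Phi E I zstar.
  by apply: CQW; apply: e0W; exact: L2ball_center.
pose xs := final_state t0 T x0 zstar.
have Gc k : k \in E :|: I -> forall p : 'rV[R]_n,
    {for xs, continuous (fun x => dotv (gradx (Phi k) x T) p)}.
  move=> kEI p.
  exact: (@gradx_dotv_continuous _ _ (Phi k) T p (Phi_C1 k kEI) xs).
have [a a0 /nbhs_normP[r /= r0 hull_near]] :=
  @signed_hulls_bounded_away _ _ _ 'rV[R]_n (fun k x => gradx (Phi k) x T)
    E I xs d Gc Gfree Gd0 Gdlt0.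
(* The L2 radius [e] is chosen so that final states stay within the radius [r] on which the hulls
   avoid 0. *)
have [e e_gt0 dist_lt] := state_of_continuous_L2 x0 t0_lt_T r0 pz.
exists (L2ball t0 T (zstar, ustar) e), a; split=> //.
  by exists e.
move=> z u [/= pcz _ zz _] phi0.
rewrite subdiff_signed_gradients//.
apply: (hull_near _ (dist_lt _ pcz zz)
  (fun k => (Phi k (final_state t0 T x0 z) T < 0)%R)).
- by move=> k [].
- by move=> j [].
- exact: act_neq0.
Qed.
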